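(* The metric space $(\mathcal{T}/{\approx},d)$ is compact.
   Context: A tree is a directed graph with a root from which every node is reachable by a unique directed path (not necessarily finitely branching); trees are unordered and identified up to isomorphism; $\mathcal{T}$ is the class of all trees. Let $\mathcal{P}_f$ be the finite power set functor, $\mathcal{P}_f^0 1=\{*\}$, $\mathcal{P}_f^{n+1}1=\mathcal{P}_f(\mathcal{P}_f^n1)$. For a tree $t$ and node $x$ define $\rho^t_0(x)=*$, $\rho^t_{n+1}(x)=\{\rho^t_n(y): y\text{ a child of }x\}$, and $\partial_n(t)=\rho^t_n(\mathrm{root}(t))$. Trees $s,t$ are Barr-equivalent, $s\approx t$, if $\partial_n(s)=\partial_n(t)$ for all $n$. The metric $d$ on $\mathcal{T}/{\approx}$ is induced by $d(s,t)=\inf\{2^{-n}: n<\omega,\ \partial_n(s)=\partial_n(t)\}$ (infimum of an infinite set being $0$); $\mathcal{T}/{\approx}$ is a set of cardinality $2^{\aleph_0}$. *)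

(* Defs.v *)
From HB Require Import structures.
From mathcomp Require Import all_boot all_order all_algebra.
From mathcomp Require Import generic_quotient.
From mathcomp Require Import all_classical all_reals all_analysis.

Set Implicit Arguments.
Unset Strict Implicit.
Unset Printing Implicit Defensive.

Import Order.TTheory GRing.Theory Num.Theory.
Local Open Scope quotient_scope.
Local Open Scope classical_set_scope.
Local Open Scope ring_scope.

(* A directed path from [root] to [x] is given by the sequence [p] of the nodes
   visited after [root]; no bound is put on the number of children of a node.
   The edge relation is boolean so that [path] applies; classically this is no
   restriction. *)
Record tree := Tree {
  node : Type;
  edge : rel node;
  root : node;
  rootP : forall x, exists! p : seq node, path edge root p /\ last root p = x
}.

HB.instance Definition _ := gen_eqMixin tree.
HB.instance Definition _ := gen_choiceMixin tree.

(* Every [Pfin n] is finite, so its finite power set consists of all its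
   subsets. *)
Fixpoint Pfin (n : nat) : finType :=
  if n is m.+1 then {set Pfin m} else unit.

Fixpoint rho (t : tree) (n : nat) : node t -> Pfin n :=
  if n is m.+1 return node t -> Pfin n then
    fun x => [set v : Pfin m | `[< exists2 y, edge x y & rho m y = v >]]%SET
  else fun=> tt.

Definition bdry (n : nat) (t : tree) : Pfin n := rho n (root t).

Definition barr_equiv (s t : tree) : Prop := forall n, bdry n s = bdry n t.

Definition barr_rel (s t : tree) : bool := `[< barr_equiv s t >].

Lemma barr_rel_refl : reflexive barr_rel.
Proof. by move=> t; exact/asboolP. Qed.

Lemma barr_rel_sym : symmetric barr_rel.
Proof. by move=> s t; apply/asboolP/asboolP => st n; rewrite st. Qed.

Lemma barr_rel_trans : transitive barr_rel.
Proof.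
by move=> t s u /asboolP st /asboolP tu; apply/asboolP => n; rewrite st tu.
Qed.

Canonical barr_rel_equiv :=
  EquivRel barr_rel barr_rel_refl barr_rel_sym barr_rel_trans.

(* Trees need not be identified up to isomorphism before taking the quotient:
   isomorphic trees are Barr-equivalent. *)
Definition tree_iso (s t : tree) : Prop :=
  exists f : node s -> node t,
    [/\ bijective f, f (root s) = root t &
        forall x y, edge (f x) (f y) = edge x y].

Lemma tree_iso_barr_equiv s t : tree_iso s t -> barr_equiv s t.
Proof.
case=> f [[g fK gK] f_root f_edge] n; rewrite /bdry -f_root.
elim: n (root s) => [//|n IHn] x /=.
apply/finset.setP => v; rewrite !finset.inE.
apply/asboolP/asboolP => -[y xy <-].
  by exists (f y); rewrite ?f_edge.
by exists (g y); rewrite ?IHn ?gK // -f_edge gK.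
Qed.

Lemma rho_pred (s t : tree) n (x : node s) (y : node t) :
  rho n.+1 x = rho n.+1 y -> rho n x = rho n y.
Proof.
elim: n x y => [//|n IHn] x y /finset.setP xy; apply/finset.setP => v.
rewrite !finset.inE.
apply/asboolP/asboolP => -[z ez <-].
- have := xy (rho n.+1 z); rewrite !finset.inE => /esym.
  have -> : `[< exists2 y, edge x y & rho n.+1 y = rho n.+1 z >] = true.
    by apply/asboolP; exists z.
  by move=> /asboolP[w yw /esym/IHn wz]; exists w.
- have := xy (rho n.+1 z); rewrite !finset.inE.
  have -> : `[< exists2 x, edge y x & rho n.+1 x = rho n.+1 z >] = true.
    by apply/asboolP; exists z.
  by move=> /asboolP[w yw /IHn wz]; exists w.
Qed.

Lemma bdry_le (s t : tree) m n :
  (m <= n)%N -> bdry n s = bdry n t -> bdry m s = bdry m t.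
Proof.
move=> /subnK <-; elim: (n - m)%N => [//|k IHk].
by rewrite addSn => /rho_pred /IHk.
Qed.

Section tree_dist.
Variable R : realType.

Definition agreement (s t : tree) : set R :=
  [set 2 ^- n | n in [set n | bdry n s = bdry n t]].

Definition tree_dist (s t : tree) : R := inf (agreement s t).

Lemma agreement_has_inf s t : has_inf (agreement s t).
Proof.
split; first by exists 1; exists 0%N => //=; rewrite expr0 invr1.
by exists 0 => _ [n _ <-]; rewrite invr_ge0 exprn_ge0.
Qed.

Lemma tree_dist_ge0 s t : 0 <= tree_dist s t.
Proof.
apply: lb_le_inf; first by case: (agreement_has_inf s t).
by move=> _ [n _ <-]; rewrite invr_ge0 exprn_ge0.
Qed.

Lemma tree_dist_le s t n : bdry n s = bdry n t -> tree_dist s t <= 2 ^- n.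
Proof.
by move=> st; apply: ge_inf; [case: (agreement_has_inf s t)|exists n].
Qed.

Lemma tree_dist_lt s t e : tree_dist s t < e ->
  exists2 n, bdry n s = bdry n t & 2 ^- n < e.
Proof.
by move=> /(inf_lt (agreement_has_inf s t).1)[_ [n st <-] ne]; exists n.
Qed.

Lemma tree_dist_ultra s t u :
  tree_dist s u <= Num.max (tree_dist s t) (tree_dist t u).
Proof.
apply/ler_addgt0Pl => e e0; set M := Num.max _ _.
have [|m st me] := @tree_dist_lt s t (e + M).
  by rewrite (@le_lt_trans _ _ M) ?ltrDr // le_max lexx.
have [|n tu ne] := @tree_dist_lt t u (e + M).
  by rewrite (@le_lt_trans _ _ M) ?ltrDr // le_max lexx orbT.
have [mn|/ltnW nm] := leqP m n.
  by rewrite (le_trans _ (ltW me)) // tree_dist_le // st (bdry_le mn tu).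
by rewrite (le_trans _ (ltW ne)) // tree_dist_le // (bdry_le nm st).
Qed.

Lemma tree_dist_sym s t : tree_dist s t = tree_dist t s.
Proof.
by congr inf; apply/seteqP; split => _ [n st <-]; exists n.
Qed.

Lemma tree_dist_eq0 s t : (tree_dist s t = 0) <-> barr_equiv s t.
Proof.
split=> [st0 n|st].
  have [|k st kn] := @tree_dist_lt s t (2 ^- n).
    by rewrite st0 invr_gt0 exprn_gt0.
  apply: bdry_le st; apply: ltnW.
  by move: kn; rewrite ltf_pV2 ?posrE ?exprn_gt0 // ltr_eXn2l ?ltr1n.
apply/eqP; rewrite eq_le tree_dist_ge0 andbT; apply/ler_addgt0Pl => e e0.
rewrite addr0; have [n ne] : exists n, 2 ^- n < e :> R.
  have /cvgrPdist_lt/(_ e e0)[n _ /(_ n (leqnn n))] /= :=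
    @cvg_expr R 2^-1 ltac:(by rewrite ger0_norm ?invf_lt1 ?invr_ge0 ?ltr1n).
  by rewrite sub0r normrN ger0_norm ?exprn_ge0 ?invr_ge0 // exprVn; exists n.
by rewrite (le_trans (tree_dist_le (st n))) // ltW.
Qed.

Lemma tree_dist_barr s s' t t' : barr_equiv s s' -> barr_equiv t t' ->
  tree_dist s t = tree_dist s' t'.
Proof.
move=> ss tt; congr inf; apply/seteqP; split => _ [n st <-]; exists n => //=.
  by rewrite -ss -tt.
by rewrite ss tt.
Qed.

End tree_dist.

(* The parameter [R] fixes the real numbers in which the distance takes its
   values. *)
Definition barr_space (R : realType) : Type := {eq_quot barr_rel}.

Section barr_metric.
Variable R : realType.
Local Notation Q := {eq_quot barr_rel}.

HB.instance Definition _ := Choice.on (barr_space R).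

Definition barr_class (t : tree) : barr_space R := \pi_Q t.

Definition barr_repr (x : barr_space R) : tree := repr (x : Q).

Lemma barr_reprK x : barr_class (barr_repr x) = x.
Proof. exact: reprK. Qed.

Lemma barr_classP s t : barr_class s = barr_class t <-> barr_equiv s t.
Proof.
split; first by move/eqmodP => /= /asboolP.
by move=> st; apply/eqmodP => /=; apply/asboolP.
Qed.

Definition barr_dist (x y : barr_space R) : R :=
  tree_dist R (barr_repr x) (barr_repr y).

Lemma barr_distxx x : barr_dist x x = 0.
Proof. exact/tree_dist_eq0. Qed.

Lemma barr_dist_positivity x y : barr_dist x y = 0 -> x = y.
Proof.
move=> /tree_dist_eq0 xy; rewrite -(barr_reprK x) -(barr_reprK y).
exact/barr_classP.
Qed.

Lemma barr_dist_sym x y : barr_dist x y = barr_dist y x.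
Proof. exact: tree_dist_sym. Qed.

Lemma barr_dist_triangle y x z : barr_dist x z <= barr_dist x y + barr_dist y z.
Proof.
rewrite (le_trans (tree_dist_ultra R _ (barr_repr y) _)) //.
by rewrite ge_max lerDl lerDr !tree_dist_ge0.
Qed.

HB.instance Definition _ := isMetric.Build R (barr_space R)
  barr_distxx barr_dist_positivity barr_dist_sym barr_dist_triangle.

Lemma mdist_barr_class s t :
  mdist (barr_class s) (barr_class t) = tree_dist R s t.
Proof. by apply: tree_dist_barr; apply/barr_classP; rewrite barr_reprK. Qed.

End barr_metric.

(* Main.v *)
(** A sequence [v n : Pfin n] of boundaries that is coherent under truncation is
    realised by a tree: the coherent sequences form a graph, with an edge from
    [x] to [y] when [y n \in x n.+1] for all [n], and its unfolding at [v] has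
    boundaries [v n], because truncation maps [x n.+2] onto [x n.+1], so that
    every element of [x n.+1] extends to a successor of [x].  An ultrafilter on
    the quotient selects a boundary at every level, since [Pfin n] is finite;
    these boundaries are coherent, and the ultrafilter converges to the class of
    a tree that realises them. *)

Require Import Defs.
From mathcomp Require Import all_boot all_order all_algebra.
From mathcomp Require Import all_classical all_reals all_analysis.

Import Order.TTheory GRing.Theory Num.Theory.
Local Open Scope classical_set_scope.

Set Implicit Arguments.
Unset Strict Implicit.
Unset Printing Implicit Defensive.

Section unfolding.
Variables (T : Type) (e : rel T) (x0 : T).

(** The sequence omits the starting point [x0], so the root is the empty path. *)
Definition unfold_node := {p : seq T | path e x0 p}.

Definition unfold_root : unfold_node := exist _ [::] isT.

Definition unfold_edge : rel unfold_node :=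
  fun p q => `[< exists y, sval q = rcons (sval p) y >].

Lemma unfold_node_inj (p q : unfold_node) : sval p = sval q -> p = q.
Proof. by case: p q => p ? [q ?] /= pq; exact: eq_exist. Qed.

Lemma unfold_path_exists (p : unfold_node) :
  exists s, path unfold_edge unfold_root s /\ last unfold_root s = p.
Proof.
case: p => p; elim/last_ind: p => [|p y IHp] py.
  by exists [::]; split => //; exact: unfold_node_inj.
have := py; rewrite rcons_path => /andP[pp _].
have [s [us ls]] := IHp pp.
exists (rcons s (exist _ (rcons p y) py)); rewrite last_rcons rcons_path us ls.
by split=> //; apply/asboolP; exists y.
Qed.

(** A path can be read backwards from its end: dropping the last entry of a node gives its only
    predecessor, and comparing sizes shows that no edge enters the root. *)
Lemma unfold_path_uniq (s s' : seq unfold_node) :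
  path unfold_edge unfold_root s -> path unfold_edge unfold_root s' ->
  last unfold_root s = last unfold_root s' -> s = s'.
Proof.
elim/last_ind: s s' => [|s p IHs] s'; case/lastP: s' => [//|s' q].
- rewrite rcons_path last_rcons /= => _ /andP[_ /asboolP[y qy]] rq.
  by move: qy; rewrite -rq => /(congr1 size); rewrite size_rcons.
- rewrite rcons_path last_rcons /= => /andP[_ /asboolP[y py]] _ pr.
  by move: py; rewrite pr => /(congr1 size); rewrite size_rcons.
- rewrite !rcons_path !last_rcons => /andP[us /asboolP[y py]].
  move=> /andP[us' /asboolP[z qz]] pq; move: qz; rewrite -pq py => /rcons_inj[].
  by move=> /unfold_node_inj ss' _; rewrite (IHs s').
Qed.

Lemma unfold_rootP (p : unfold_node) : exists! s : seq unfold_node,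
  path unfold_edge unfold_root s /\ last unfold_root s = p.
Proof.
have [s [us ls]] := unfold_path_exists p; exists s; split => // s' [us' ls'].
by apply: unfold_path_uniq; rewrite ?ls'.
Qed.

Definition unfold : tree := Tree unfold_rootP.

(** The hypothesis is the recursion of [rho] transported to the graph; children of [p] correspond to
    successors of its last vertex. *)
Lemma rho_unfold (beh : forall n, T -> Pfin n) :
  (forall n x,
    beh n.+1 x = [set v | `[< exists2 y, e x y & beh n y = v >]]%SET) ->
  forall n (p : node unfold), rho n p = beh n (last x0 (sval p)).
Proof.
move=> behS; elim=> [|n IHn] p; first by case: (beh 0%N _).
rewrite behS /=; apply/finset.setP => v; rewrite !finset.inE.
apply/asboolP/asboolP => -[].
- move=> q /asboolP[y qy] <-; exists y; last by rewrite IHn qy last_rcons.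
  by have := svalP q; rewrite qy rcons_path => /andP[].
- move=> y ey <-.
  have py : path e x0 (rcons (sval p) y) by rewrite rcons_path ey (svalP p).
  exists (exist _ (rcons (sval p) y) py); last by rewrite IHn /= last_rcons.
  by apply/asboolP; exists y.
Qed.

Lemma bdry_unfold (beh : forall n, T -> Pfin n) :
  (forall n x,
    beh n.+1 x = [set v | `[< exists2 y, e x y & beh n y = v >]]%SET) ->
  forall n, bdry n unfold = beh n x0.
Proof. by move=> behS n; rewrite /bdry (rho_unfold behS). Qed.

End unfolding.

(* Meaningful for [m <= n] only; leaving [m] and [n] unrelated avoids casts
   between the types [Pfin n]. *)
Fixpoint trunc m n : Pfin n -> Pfin m :=
  match m, n return Pfin n -> Pfin m with
  | 0, _ => fun=> tt
  | m'.+1, 0 => fun=> finset.set0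
  | m'.+1, n'.+1 => fun A => (@trunc m' n' @: A)%SET
  end.

Lemma trunc_id n (v : Pfin n) : trunc n v = v.
Proof.
elim: n v => [[]//|n IHn] v /=.
by rewrite (eq_imset _ IHn) imset_id.
Qed.

Lemma trunc_comp m n p (v : Pfin p) :
  (m <= n)%N -> (n <= p)%N -> trunc m (trunc n v) = trunc m v.
Proof.
elim: m n p v => [//|m IHm] [//|n] [//|p] v /= mn np.
by rewrite -imset_comp; apply: eq_imset => w /=; exact: IHm.
Qed.

Lemma trunc_rho (t : tree) (x : node t) m n :
  (m <= n)%N -> trunc m (rho n x) = rho m x.
Proof.
elim: m n x => [//|m IHm] [//|n] x mn.
apply/finset.setP => v; rewrite !finset.inE /=; apply/imsetP/asboolP.
- move=> [w]; rewrite finset.inE => /asboolP[y xy <-] ->.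
  by exists y; rewrite ?IHm.
- move=> [y xy <-]; exists (rho n y); last by rewrite IHm.
  by rewrite finset.inE; apply/asboolP; exists y.
Qed.

(** These are the points of the inverse limit of the finite sets [Pfin n]. *)
Definition coherent (x : forall n, Pfin n) : Prop :=
  forall n, trunc n (x n.+1) = x n.

Lemma coherent_trunc x m n : coherent x -> (m <= n)%N -> trunc m (x n) = x m.
Proof.
move=> xc /subnK <-; elim: (n - m)%N => [|k IHk]; first exact: trunc_id.
by rewrite addSn -(@trunc_comp _ (k + m)) ?leq_addl // xc.
Qed.

Lemma coherent_lift x n (v : Pfin n) : coherent x -> v \in x n.+1 ->
  exists2 w : Pfin n.+1, w \in x n.+2 & trunc n w = v.
Proof. by move=> xc; rewrite -xc => /imsetP[w wx ->]; exists w. Qed.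

(** Dependent choice lifts [v] one level at a time inside [x]; the levels below [n] are
    truncations. *)
Lemma coherent_extend x n (v : Pfin n) : coherent x -> v \in x n.+1 ->
  exists y, [/\ coherent y, y n = v & forall m, y m \in x m.+1].
Proof.
move=> xc vx.
have lift k (w : {w : Pfin k | w \in x k.+1}) :
    {w' : {w' : Pfin k.+1 | w' \in x k.+2} | trunc k (sval w') = sval w}.
  apply: cid; have [w' w'x w'w] := coherent_lift xc (svalP w).
  by exists (exist _ w' w'x).
(* With the level written [k + n], both the base case and the successor step typecheck by
   computation. *)
pose u := nat_rect (fun k => {w : Pfin (k + n) | w \in x (k + n).+1})
  (exist _ v vx) (fun k w => sval (lift _ w)).
have uS k : trunc (k + n) (sval (u k.+1)) = sval (u k).
  exact: svalP (lift _ (u k)).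
(* Since [u m] has level [m + n], at least [m], truncating it covers the levels below and above [n]
   uniformly. *)
exists (fun m => trunc m (sval (u m))); split.
- move=> m; rewrite trunc_comp ?leq_addr //.
  by rewrite -(@trunc_comp m (m + n)) ?leq_addr // uS.
- suff uv k : trunc n (sval (u k)) = v by exact: uv.
  elim: k => [|k IHk]; first exact: trunc_id.
  by rewrite -(@trunc_comp n (k + n)) ?leq_addl // uS.
- move=> m; rewrite -(coherent_trunc xc (leq_addr n m.+1)).
  exact/imset_f/(svalP (u m)).
Qed.

(** The term [trunc n 0 tt] only serves as an inhabitant of [Pfin n], the value at indices out of
    range. *)
Definition decode n (i : nat) : Pfin n :=
  nth (@trunc n 0 tt) (enum {: Pfin n}) i.

Lemma decode_index n (v : Pfin n) : decode n (index v (enum {: Pfin n})) = v.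
Proof. by rewrite /decode nth_index ?mem_enum. Qed.

(* Entries are stored as natural numbers: the type of nodes of a tree is
   confined to a universe below that of [finType], hence cannot mention
   [Pfin n] itself. *)
Definition limit_node :=
  {r : nat -> nat | coherent (fun n => decode n (r n))}.

Definition limit_val n (x : limit_node) : Pfin n := decode n (sval x n).

Lemma coherent_limit_val x : coherent x ->
  exists y : limit_node, forall n, limit_val n y = x n.
Proof.
move=> xc.
have rc : coherent (fun n => decode n (index (x n) (enum {: Pfin n}))).
  by move=> n; rewrite !decode_index.
by exists (exist _ (fun n => index (x n) _) rc) => n; exact: decode_index.
Qed.

Definition limit_edge : rel limit_node :=
  fun x y => `[< forall n, limit_val n y \in limit_val n.+1 x >].

Lemma coherent_bdry x : coherent x -> exists t, forall n, bdry n t = x n.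
Proof.
move=> /coherent_limit_val[x0 x0E]; exists (unfold limit_edge x0) => n.
rewrite -x0E; apply: bdry_unfold => {}n y.
apply/finset.setP => v; rewrite finset.inE; apply/idP/asboolP.
- move=> /(coherent_extend (svalP y))[z [/coherent_limit_val[z' z'E] zv zy]].
  by exists z'; [apply/asboolP => m; rewrite z'E; exact: zy|rewrite z'E].
- by move=> [z /asboolP zy <-].
Qed.

(** Otherwise [F] contains the complements of all fibres, hence their finite intersection, which is
    empty. *)
Lemma ultra_fiber (T : Type) (I : finType) (F : set_system T) (f : T -> I) :
  UltraFilter F -> exists i, F [set x | f x = i].
Proof.
move=> FU; apply: contrapT => nF.
have /filter_ex[x /(_ (f x))] : \forall x \near F, forall i, f x <> i; last by [].
apply: filter_forall => i.
by have [Fi|//] := in_ultra_setVsetC [set x | f x = i] FU; case: nF; exists i.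
Qed.

Theorem theoremC3 (R : realType) : compact [set: barr_space R].
Proof.
rewrite compact_ultra => F FU _.
pose A n (v : Pfin n) := [set q : barr_space R | bdry n (barr_repr q) = v].
have Fv n : {v | F (A n v)} by apply: cid; exact: ultra_fiber.
have vc : coherent (fun n => sval (Fv n)).
  move=> n; have [q [qn <-]] :=
    filter_ex (filterI (svalP (Fv n.+1)) (svalP (Fv n))).
  by rewrite -qn trunc_rho.
have [t tv] := coherent_bdry vc; exists (barr_class R t); split=> //.
apply/metricType_numDomainType.fcvgrPdist_lt => e e0.
(* The distance from [t] to itself is 0, hence below [e], which yields an [n] with [2 ^- n < e]. *)
have [|n _ ne] := @tree_dist_lt R t t e.
  by rewrite (tree_dist_eq0 R t t).2.
apply: filterS (svalP (Fv n)) => q qn.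
rewrite -(barr_reprK q) mdist_barr_class (le_lt_trans _ ne) //.
by apply: tree_dist_le; rewrite tv.
Qed.
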